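(* There exists a covariant functor $\Gamma$ from the category $Sch$ of schemes to the category $Grph$ of graphs defined as follows. (i) To each scheme $X$, $\Gamma$ assigns the graph $\Gamma(X)$ whose vertex set is the set of points of the underlying space of $X$ and whose edge set is the set of specializations in $X$; that is, for any points $x,y\in X$ there is an edge from $x$ to $y$ if and only if there is a specialization $x\rightarrow y$ in $X$. (ii) To each morphism $f:X\rightarrow Y$ of schemes, $\Gamma$ assigns the homomorphism of graphs $\Gamma(f):\Gamma(X)\rightarrow\Gamma(Y)$ such that any specialization $x\rightarrow y$ in $X$, regarded as an edge in $\Gamma(X)$, is mapped by $\Gamma(f)$ to the specialization $f(x)\rightarrow f(y)$, regarded as an edge in $\Gamma(Y)$.
   Context: For points $x,y$ of a topological space $E$, $y$ is a specialization of $x$, written $x\rightarrow y$, if $y\in\overline{\{x\}}$. In particular $x\rightarrow x$ always holds. A graph is given by a vertex set together with a set of edges, each going from a vertex to a vertex (loops allowed). A homomorphism of graphs is a map of vertex sets sending each edge from $x$ to $y$ to an edge from the image of $x$ to the image of $y$. *)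

(* Defs.v *)
From HB Require Import structures.
From mathcomp Require Import all_boot all_algebra.
From mathcomp Require Import ring.
From mathcomp Require Import all_classical topology.

Set Implicit Arguments.
Unset Strict Implicit.
Unset Printing Implicit Defensive.

Import GRing.Theory.
Local Open Scope classical_set_scope.
Local Open Scope ring_scope.

Record category := Category {
  ob :> Type;
  mor : ob -> ob -> Type;
  idm : forall X, mor X X;
  compose : forall X Y Z, mor Y Z -> mor X Y -> mor X Z;
  comp_idl : forall X Y (f : mor X Y), compose (idm Y) f = f;
  comp_idr : forall X Y (f : mor X Y), compose f (idm X) = f;
  comp_assoc : forall X Y Z T (h : mor Z T) (g : mor Y Z) (f : mor X Y),
    compose h (compose g f) = compose (compose h g) f
}.
Arguments mor {c}.
Arguments idm {c}.
Arguments compose {c X Y Z}.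

Record is_functor (C D : category) (F0 : C -> D)
    (F1 : forall X Y : C, mor X Y -> mor (F0 X) (F0 Y)) : Prop := IsFunctor {
  functor_id : forall X : C, F1 X X (idm X) = idm (F0 X);
  functor_comp : forall (X Y Z : C) (g : mor Y Z) (f : mor X Y),
    F1 X Z (compose g f) = compose (F1 Y Z g) (F1 X Y f)
}.

(* A homomorphism is a map of vertices and only sees the endpoints of edges,
   so the edges form a set of ordered pairs of vertices. *)
Record graph := Graph {
  vertex :> Type;
  edges : set (vertex * vertex)
}.

Record graph_hom (G H : graph) := GraphHom {
  vmap :> G -> H;
  vmap_edge : forall x y, edges (x, y) -> edges (vmap x, vmap y)
}.

Lemma graph_hom_eq (G H : graph) (f g : graph_hom G H) :
  (forall x, f x = g x) -> f = g.
Proof.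
case: f g => [f pf] [g pg] /= /funext fg; subst g.
by rewrite (Prop_irrelevance pf pg).
Qed.

Definition graph_id (G : graph) : graph_hom G G :=
  @GraphHom G G id (fun _ _ e => e).

Definition graph_comp (G H K : graph) (g : graph_hom H K) (f : graph_hom G H) :
    graph_hom G K :=
  @GraphHom G K (g \o f) (fun _ _ e => vmap_edge g (vmap_edge f e)).

Definition Grph : category.
Proof.
refine (@Category graph graph_hom graph_id graph_comp _ _ _) => *;
  exact: graph_hom_eq.
Defined.

(* [comPzRingType] admits the zero ring, which is the ring of sections over the
   empty set; the ideals of [ring_quotient] require a nonzero ring. *)

Section Ideals.
Variable A : comPzRingType.

Definition ideal (I : set A) : Prop :=
  [/\ I 0, forall a b, I a -> I b -> I (a + b) & forall a b, I b -> I (a * b)].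

Definition prime_ideal (p : set A) : Prop :=
  [/\ ideal p, ~ p 1 & forall a b, p (a * b) -> p a \/ p b].

Definition maximal_ideal (m : set A) : Prop :=
  [/\ ideal m, ~ m 1 & forall I, ideal I -> ~ I 1 -> m `<=` I -> I = m].

Definition local_ring : Prop := exists! m, maximal_ideal m.

End Ideals.

(* Used only between local rings, where [m] and [n] are unique. *)
Definition local_hom (A B : comPzRingType) (f : A -> B) : Prop :=
  forall (m : set A) (n : set B), maximal_ideal m -> maximal_ideal n ->
  f @` m `<=` n.

Record setoid_ring := SetoidRing {
  sr_car :> Type;
  sr_eq : sr_car -> sr_car -> Prop;
  sr_zero : sr_car;
  sr_one : sr_car;
  sr_opp : sr_car -> sr_car;
  sr_add : sr_car -> sr_car -> sr_car;
  sr_mul : sr_car -> sr_car -> sr_car;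
  sr_refl : forall x, sr_eq x x;
  sr_sym : forall x y, sr_eq x y -> sr_eq y x;
  sr_trans : forall x y z, sr_eq x y -> sr_eq y z -> sr_eq x z;
  sr_oppE : forall x x', sr_eq x x' -> sr_eq (sr_opp x) (sr_opp x');
  sr_addE : forall x x' y y', sr_eq x x' -> sr_eq y y' ->
    sr_eq (sr_add x y) (sr_add x' y');
  sr_mulE : forall x x' y y', sr_eq x x' -> sr_eq y y' ->
    sr_eq (sr_mul x y) (sr_mul x' y');
  sr_addA : forall x y z,
    sr_eq (sr_add x (sr_add y z)) (sr_add (sr_add x y) z);
  sr_addC : forall x y, sr_eq (sr_add x y) (sr_add y x);
  sr_add0 : forall x, sr_eq (sr_add sr_zero x) x;
  sr_addN : forall x, sr_eq (sr_add (sr_opp x) x) sr_zero;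
  sr_mulA : forall x y z,
    sr_eq (sr_mul x (sr_mul y z)) (sr_mul (sr_mul x y) z);
  sr_mulC : forall x y, sr_eq (sr_mul x y) (sr_mul y x);
  sr_mul1 : forall x, sr_eq (sr_mul sr_one x) x;
  sr_mulD : forall x y z,
    sr_eq (sr_mul (sr_add x y) z) (sr_add (sr_mul x z) (sr_mul y z))
}.

Section RingQuotient.
Variable S : setoid_ring.

Record ring_quot := RingQuot {
  rq_class : set S;
  rq_classP : exists x, rq_class = sr_eq x
}.

HB.instance Definition _ := gen_eqMixin ring_quot.
HB.instance Definition _ := gen_choiceMixin ring_quot.

Definition rq_pi (x : S) : ring_quot := RingQuot (ex_intro _ x erefl).
Definition rq_repr (q : ring_quot) : S := projT1 (cid (rq_classP q)).

Lemma rq_piP (x y : S) : rq_pi x = rq_pi y <-> sr_eq x y.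
Proof.
split=> [[e]|xy]; first by rewrite e; exact: sr_refl.
rewrite /rq_pi.
have e : sr_eq x = sr_eq y.
  apply/predeqP => z; split; last exact: sr_trans.
  exact/sr_trans/sr_sym.
move: (ex_intro _ x _) (ex_intro _ y _); rewrite e => p q.
by rewrite (Prop_irrelevance p q).
Qed.

Lemma rq_reprK (q : ring_quot) : rq_pi (rq_repr q) = q.
Proof.
rewrite /rq_repr; case: cid => x /=; case: q => C CP /= e; subst C.
by rewrite /rq_pi; congr RingQuot.
Qed.

Lemma rq_repr_pi (x : S) : sr_eq (rq_repr (rq_pi x)) x.
Proof. by apply/rq_piP; rewrite rq_reprK. Qed.

Definition rq_opp (q : ring_quot) := rq_pi (sr_opp (rq_repr q)).
Definition rq_add (q r : ring_quot) := rq_pi (sr_add (rq_repr q) (rq_repr r)).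
Definition rq_mul (q r : ring_quot) := rq_pi (sr_mul (rq_repr q) (rq_repr r)).

Lemma rq_oppE x : rq_opp (rq_pi x) = rq_pi (sr_opp x).
Proof. exact/rq_piP/sr_oppE/rq_repr_pi. Qed.
Lemma rq_addE x y : rq_add (rq_pi x) (rq_pi y) = rq_pi (sr_add x y).
Proof. by apply/rq_piP/sr_addE; exact: rq_repr_pi. Qed.
Lemma rq_mulE x y : rq_mul (rq_pi x) (rq_pi y) = rq_pi (sr_mul x y).
Proof. by apply/rq_piP/sr_mulE; exact: rq_repr_pi. Qed.

Lemma rq_addA : associative rq_add.
Proof.
move=> x y z; rewrite -[x]rq_reprK -[y]rq_reprK -[z]rq_reprK !rq_addE.
exact/rq_piP/sr_addA.
Qed.
Lemma rq_addC : commutative rq_add.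
Proof.
move=> x y; rewrite -[x]rq_reprK -[y]rq_reprK !rq_addE.
exact/rq_piP/sr_addC.
Qed.
Lemma rq_add0 : left_id (rq_pi (sr_zero S)) rq_add.
Proof. move=> x; rewrite -[x]rq_reprK !rq_addE; exact/rq_piP/sr_add0. Qed.
Lemma rq_addN : left_inverse (rq_pi (sr_zero S)) rq_opp rq_add.
Proof.
move=> x; rewrite -[x]rq_reprK rq_oppE rq_addE; exact/rq_piP/sr_addN.
Qed.
Lemma rq_mulA : associative rq_mul.
Proof.
move=> x y z; rewrite -[x]rq_reprK -[y]rq_reprK -[z]rq_reprK !rq_mulE.
exact/rq_piP/sr_mulA.
Qed.
Lemma rq_mulC : commutative rq_mul.
Proof.
move=> x y; rewrite -[x]rq_reprK -[y]rq_reprK !rq_mulE.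
exact/rq_piP/sr_mulC.
Qed.
Lemma rq_mul1 : left_id (rq_pi (sr_one S)) rq_mul.
Proof. move=> x; rewrite -[x]rq_reprK !rq_mulE; exact/rq_piP/sr_mul1. Qed.
Lemma rq_mulD : left_distributive rq_mul rq_add.
Proof.
move=> x y z; rewrite -[x]rq_reprK -[y]rq_reprK -[z]rq_reprK.
rewrite !(rq_mulE, rq_addE); exact/rq_piP/sr_mulD.
Qed.

HB.instance Definition _ := GRing.isZmodule.Build ring_quot
  rq_addA rq_addC rq_add0 rq_addN.
HB.instance Definition _ := GRing.Zmodule_isComPzRing.Build ring_quot
  rq_mulA rq_mulC rq_mul1 rq_mulD.

End RingQuotient.

Record opens (X : topologicalType) := Opens {
  opens_set :> set X;
  opens_open : open opens_set
}.

Definition opens_cap (X : topologicalType) (U V : opens X) : opens X :=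
  Opens (openI (opens_open U) (opens_open V)).

Lemma opens_capl (X : topologicalType) (U V : opens X) : opens_cap U V `<=` U.
Proof. by move=> x []. Qed.

Lemma opens_capr (X : topologicalType) (U V : opens X) : opens_cap U V `<=` V.
Proof. by move=> x []. Qed.

Definition opens_setT (X : topologicalType) : opens X := Opens (@openT X).

Lemma preimage_open (X Y : topologicalType) (f : X -> Y) (cf : continuous f)
  (U : opens Y) : open (f @^-1` U).
Proof. by apply: open_comp (opens_open U) => x _; exact: cf. Qed.

Definition opens_preimage (X Y : topologicalType) (f : X -> Y)
    (cf : continuous f) (U : opens Y) : opens X :=
  Opens (preimage_open cf U).

Record presheaf (X : topologicalType) := Presheaf {
  sections :> opens X -> comPzRingType;
  res : forall U V : opens X, V `<=` U -> {rmorphism sections U -> sections V};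
  res_id : forall (U : opens X) (h : U `<=` U) s, res h s = s;
  res_comp : forall (U V W : opens X) (h : V `<=` U) (k : W `<=` V)
    (l : W `<=` U) s, res k (res h s) = res l s
}.
Arguments res {X} F {U V} h : rename.

Lemma resT (X : topologicalType) (F : presheaf X) (U V W : opens X)
    (h : V `<=` U) (k : W `<=` V) s :
  res F k (res F h s) = res F (subset_trans k h) s.
Proof. exact: res_comp. Qed.

Lemma res_irr (X : topologicalType) (F : presheaf X) (U V : opens X)
    (h k : V `<=` U) s : res F h s = res F k s.
Proof. by rewrite (Prop_irrelevance h k). Qed.

Definition is_sheaf (X : topologicalType) (F : presheaf X) : Prop :=
  forall (U : opens X) (I : Type) (V : I -> opens X) (h : forall i, V i `<=` U),
  U `<=` \bigcup_i V i ->
  forall s : forall i, F (V i),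
  (forall i j, res F (@opens_capl _ (V i) (V j)) (s i) =
               res F (@opens_capr _ (V i) (V j)) (s j)) ->
  exists! t : F U, forall i, res F (h i) t = s i.

Section Stalk.
Variables (X : topologicalType) (F : presheaf X) (x : X).

Record pregerm := Pregerm {
  pg_open : opens X;
  pg_mem : opens_set pg_open x;
  pg_sec : F pg_open
}.

Definition pregerm_eq (g h : pregerm) : Prop :=
  exists (W : opens X) (kg : W `<=` pg_open g) (kh : W `<=` pg_open h),
  opens_set W x /\ res F kg (pg_sec g) = res F kh (pg_sec h).

Definition pg_const (b : bool) : pregerm :=
  @Pregerm (opens_setT X) I (if b then 1 else 0).
Definition pg_opp (g : pregerm) : pregerm := Pregerm (pg_mem g) (- pg_sec g).

Definition pg_op2 (op : forall R : comPzRingType, R -> R -> R)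
    (g h : pregerm) : pregerm :=
  @Pregerm (opens_cap (pg_open g) (pg_open h)) (conj (pg_mem g) (pg_mem h))
    (op _ (res F (@opens_capl _ (pg_open g) (pg_open h)) (pg_sec g))
          (res F (@opens_capr _ (pg_open g) (pg_open h)) (pg_sec h))).
Definition pg_add := pg_op2 (fun R => @GRing.add R).
Definition pg_mul := pg_op2 (fun R => @GRing.mul R).

Lemma pregerm_refl g : pregerm_eq g g.
Proof.
have k : pg_open g `<=` pg_open g by [].
by exists (pg_open g), k, k; split=> //; exact: pg_mem.
Qed.

Lemma pregerm_sym g h : pregerm_eq g h -> pregerm_eq h g.
Proof. by move=> [W [k [l [Wx e]]]]; exists W, l, k. Qed.

Lemma pregerm_trans g h k :
  pregerm_eq g h -> pregerm_eq h k -> pregerm_eq g k.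
Proof.
move=> [W [a [b [Wx e]]]] [W' [c [d [Wx' e']]]].
pose V := opens_cap W W'.
have VW : V `<=` W := @opens_capl _ _ _.
have VW' : V `<=` W' := @opens_capr _ _ _.
exists V, (subset_trans VW a), (subset_trans VW' d); split=> //.
rewrite -!resT e -e' !resT; exact: res_irr.
Qed.

Lemma pg_op2E (op : forall R : comPzRingType, R -> R -> R) :
  (forall (R S : comPzRingType) (f : {rmorphism R -> S}) a b,
    f (op R a b) = op S (f a) (f b)) ->
  forall g g' h h', pregerm_eq g g' -> pregerm_eq h h' ->
  pregerm_eq (pg_op2 op g h) (pg_op2 op g' h').
Proof.
move=> opM g g' h h' [W [a [b [Wx e]]]] [W' [c [d [Wx' e']]]].
pose V := opens_cap W W'.
have VW : V `<=` W := @opens_capl _ _ _.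
have VW' : V `<=` W' := @opens_capr _ _ _.
have k1 : V `<=` opens_cap (pg_open g) (pg_open h).
  by move=> z [/a ? /c ?].
have k2 : V `<=` opens_cap (pg_open g') (pg_open h').
  by move=> z [/b ? /d ?].
exists V, k1, k2; split=> //=;
  rewrite !opM !resT.
move: (congr1 (res F VW) e) (congr1 (res F VW') e'); rewrite !resT => E E'.
congr (op _ _ _).
  by rewrite (res_irr _ (subset_trans VW a)) E; exact: res_irr.
by rewrite (res_irr _ (subset_trans VW' c)) E'; exact: res_irr.
Qed.

Lemma pg_addE g g' h h' : pregerm_eq g g' -> pregerm_eq h h' ->
  pregerm_eq (pg_add g h) (pg_add g' h').
Proof. by apply: pg_op2E => *; exact: rmorphD. Qed.

Lemma pg_mulE g g' h h' : pregerm_eq g g' -> pregerm_eq h h' ->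
  pregerm_eq (pg_mul g h) (pg_mul g' h').
Proof. by apply: pg_op2E => *; exact: rmorphM. Qed.

Definition stalk_setoid : setoid_ring.
Proof.
refine (@SetoidRing pregerm pregerm_eq (pg_const false) (pg_const true)
  pg_opp pg_add pg_mul pregerm_refl pregerm_sym pregerm_trans _
  pg_addE pg_mulE _ _ _ _ _ _ _ _).
- move=> g g' [W [a [b [Wx e]]]].
  by exists W, a, b; split=> //=; rewrite !rmorphN e.
- move=> [U Ux s] [V Vx t] [W Wx u].
  pose N := opens_cap (opens_cap U V) W.
  have k : N `<=` opens_cap U (opens_cap V W) by move=> z [[]].
  have l : N `<=` N by [].
  exists N, k, l; split=> //=; rewrite !(rmorphD, resT) addrA.
  by congr (_ + _ + _); exact: res_irr.
- move=> [U Ux s] [V Vx t].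
  pose N := opens_cap U V.
  have k : N `<=` opens_cap V U by move=> z [].
  have l : N `<=` N by [].
  exists N, l, k; split=> //=; rewrite !(rmorphD, resT) addrC.
  by congr (_ + _); exact: res_irr.
- move=> [U Ux s].
  have k : U `<=` opens_cap (opens_setT X) U by [].
  have l : U `<=` U by [].
  exists U, k, l; split=> //=.
  by rewrite !(rmorphD, resT, rmorph0) add0r; exact: res_irr.
- move=> [U Ux s].
  have k : U `<=` opens_cap U U by [].
  have l : U `<=` opens_setT X by [].
  exists U, k, l; split=> //=.
  rewrite !(rmorphD, rmorphN, resT, rmorph0) addrC.
  by apply/eqP; rewrite subr_eq0; apply/eqP; exact: res_irr.
- move=> [U Ux s] [V Vx t] [W Wx u].
  pose N := opens_cap (opens_cap U V) W.
  have k : N `<=` opens_cap U (opens_cap V W) by move=> z [[]].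
  have l : N `<=` N by [].
  exists N, k, l; split=> //=; rewrite !(rmorphM, resT) mulrA.
  by congr (_ * _ * _); exact: res_irr.
- move=> [U Ux s] [V Vx t].
  pose N := opens_cap U V.
  have k : N `<=` opens_cap V U by move=> z [].
  have l : N `<=` N by [].
  exists N, l, k; split=> //=; rewrite !(rmorphM, resT) mulrC.
  by congr (_ * _); exact: res_irr.
- move=> [U Ux s].
  have k : U `<=` opens_cap (opens_setT X) U by [].
  have l : U `<=` U by [].
  exists U, k, l; split=> //=.
  by rewrite !(rmorphM, resT, rmorph1) mul1r; exact: res_irr.
- move=> [U Ux s] [V Vx t] [W Wx u].
  pose N := opens_cap (opens_cap U V) W.
  have k : N `<=` opens_cap (opens_cap U W) (opens_cap V W) by move=> z [[]].
  have l : N `<=` N by [].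
  exists N, l, k; split=> //=.
  rewrite !(rmorphM, rmorphD, resT) mulrDl.
  by congr (_ * _ + _ * _); exact: res_irr.
Defined.

Definition stalk : comPzRingType := ring_quot stalk_setoid.

Definition germ (U : opens X) (Ux : opens_set U x) (s : F U) : stalk :=
  @rq_pi stalk_setoid (Pregerm Ux s).

End Stalk.

Record ringed_space := RingedSpace {
  rs_space :> topologicalType;
  rs_presheaf : presheaf rs_space;
  rs_sheaf : is_sheaf rs_presheaf
}.
Notation "'\O_' X" := (rs_presheaf X)
  (at level 0, X at level 2, format "'\O_' X").

Record rs_mor (X Y : ringed_space) := RSMor {
  rsm_fun :> X -> Y;
  rsm_cont : continuous rsm_fun;
  rsm_sharp : forall U : opens Y,
    {rmorphism \O_Y U -> \O_X (opens_preimage rsm_cont U)};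
  rsm_nat : forall (U V : opens Y) (h : V `<=` U)
    (k : opens_preimage rsm_cont V `<=` opens_preimage rsm_cont U) s,
    rsm_sharp V (res \O_Y h s) = res \O_X k (rsm_sharp U s)
}.

Local Notation preim f := (opens_preimage (@rsm_cont _ _ f)).

Lemma rmorphism_eq (R S : comPzRingType) (f g : {rmorphism R -> S}) :
  (forall x, f x = g x) -> f = g.
Proof.
case: f => f [[f1] [f2]]; case: g => g [[g1] [g2]] /= /funext fg; subst g.
by rewrite (Prop_irrelevance f1 g1) (Prop_irrelevance f2 g2).
Qed.

Lemma rs_mor_eq (X Y : ringed_space) (f g : rs_mor X Y)
    (fg : rsm_fun f = rsm_fun g) :
  (forall (U : opens Y) s (W : opens X)
    (h : W `<=` preim f U)
    (k : W `<=` preim g U),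
    res \O_X h (rsm_sharp f U s) = res \O_X k (rsm_sharp g U s)) ->
  f = g.
Proof.
case: f g fg => [f cf sf nf] [g cg sg ng] /= fg; subst g.
rewrite (Prop_irrelevance cg cf) in sg ng * => {cg} E.
have e : sf = sg.
  apply: functional_extensionality_dep => U; apply: rmorphism_eq => s.
  have k : opens_preimage cf U `<=` opens_preimage cf U by [].
  by have := E U s _ k k; rewrite !res_id.
by subst sg; rewrite (Prop_irrelevance nf ng).
Qed.

Section RSMorId.
Variable X : ringed_space.

Lemma rs_id_cont : continuous (@id X). Proof. by move=> x; exact: cvg_id. Qed.

Definition rs_id : rs_mor X X.
Proof.
refine (@RSMor X X id rs_id_cont (fun U =>
  res \O_X ((fun _ => id) : opens_preimage rs_id_cont U `<=` U)) _).
by move=> U V h k s; rewrite !resT; exact: res_irr.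
Defined.
End RSMorId.

Section RSMorComp.
Variables (X Y Z : ringed_space) (g : rs_mor Y Z) (f : rs_mor X Y).

Lemma rs_comp_cont : continuous (g \o f).
Proof.
by move=> x; apply: continuous_comp; [exact: rsm_cont | exact: rsm_cont].
Qed.

Definition rs_comp : rs_mor X Z.
Proof.
refine (@RSMor X Z (g \o f) rs_comp_cont (fun U =>
  res \O_X ((fun _ => id) : opens_preimage rs_comp_cont U `<=`
    preim f (preim g U))
  \o rsm_sharp f _ \o rsm_sharp g U) _).
move=> U V h k s /=.
have hg : preim g V `<=`
  preim g U by move=> y /h.
have hf : preim f (preim g V)
  `<=` preim f (preim g U).
  by move=> x /h.
rewrite (rsm_nat h hg) (rsm_nat _ hf) !resT.
exact: res_irr.
Defined.
End RSMorComp.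

Lemma rs_comp_idl (X Y : ringed_space) (f : rs_mor X Y) :
  rs_comp (rs_id Y) f = f.
Proof.
apply: (@rs_mor_eq _ _ (rs_comp (rs_id Y) f) f erefl) => U s W h k /=.
have l : preim f (opens_preimage (rs_id_cont (X := Y)) U)
  `<=` preim f U by [].
by rewrite (rsm_nat _ l) !resT; exact: res_irr.
Qed.

Lemma rs_comp_idr (X Y : ringed_space) (f : rs_mor X Y) :
  rs_comp f (rs_id X) = f.
Proof.
apply: (@rs_mor_eq _ _ (rs_comp f (rs_id X)) f erefl) => U s W h k /=.
by rewrite !resT; exact: res_irr.
Qed.

Lemma rs_comp_assoc (X Y Z T : ringed_space) (h : rs_mor Z T) (g : rs_mor Y Z)
  (f : rs_mor X Y) : rs_comp h (rs_comp g f) = rs_comp (rs_comp h g) f.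
Proof.
apply: (@rs_mor_eq _ _ (rs_comp h (rs_comp g f)) (rs_comp (rs_comp h g) f) erefl).
move=> U s W k l /=.
pose hU := preim h U.
have m : preim f (opens_preimage (@rs_comp_cont _ _ _ h g) U)
  `<=` preim f (preim g hU).
  by [].
by rewrite (rsm_nat _ m) !resT; exact: res_irr.
Qed.

Definition rs_iso (X Y : ringed_space) : Prop :=
  exists (f : rs_mor X Y) (g : rs_mor Y X),
    rs_comp g f = rs_id X /\ rs_comp f g = rs_id Y.

Section Restriction.
Variables (X : ringed_space) (U : opens X).

Local Notation UT := (set_type U).

Lemma image_open (W : opens UT) : open (set_val @` W).
Proof.
case: W => W /= [C oC <-].
suff -> : set_val @` (set_val @^-1` C : set UT) = C `&` U.
  by apply: openI => //; exact: opens_open.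
apply/seteqP; split=> [_ [x Cx <-]|x [Cx Ux]].
  by split=> //; exact: set_valP.
by exists (exist _ x (mem_set Ux)).
Qed.

Definition opens_image (W : opens UT) : opens X := Opens (image_open W).

Lemma opens_imageS (W W' : opens UT) :
  W' `<=` W -> opens_image W' `<=` opens_image W.
Proof. by move=> h; exact: image_subset. Qed.

Definition restr_presheaf : presheaf UT.
Proof.
refine (@Presheaf UT (fun W => \O_X (opens_image W))
  (fun W W' h => res \O_X (opens_imageS h)) _ _).
- by move=> W h s; exact: res_id.
- by move=> V W W' h k l s; exact: res_comp.
Defined.

Lemma restr_sheaf : is_sheaf restr_presheaf.
Proof.
move=> W I V h cover s compat.
apply: (@rs_sheaf X (opens_image W) I (fun i => opens_image (V i))
  (fun i => opens_imageS (h i))).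
  by move=> _ [x /cover [i _ Vx] <-]; exists i => //; exists x.
move=> i j.
have m : opens_cap (opens_image (V i)) (opens_image (V j)) `<=`
    opens_image (opens_cap (V i) (V j)).
  move=> _ [[x Vx <-] [y Vy /val_inj yx]]; exists x => //.
  by split=> //; rewrite -yx.
have := congr1 (res \O_X m) (compat i j); rewrite /= !resT => E.
rewrite (res_irr _ (subset_trans m (opens_imageS (@opens_capl _ (V i) (V j))))).
by rewrite E; exact: res_irr.
Qed.

Definition restriction : ringed_space := RingedSpace restr_sheaf.

End Restriction.

Section StalkMap.
Variables (X Y : ringed_space) (f : rs_mor X Y) (x : X).

Definition pregerm_map (g : pregerm \O_Y (f x)) : pregerm \O_X x :=
  @Pregerm X \O_X x (preim f (pg_open g)) (pg_mem g)
    (rsm_sharp f (pg_open g) (pg_sec g)).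

Definition stalk_map (g : stalk \O_Y (f x)) : stalk \O_X x :=
  @rq_pi (stalk_setoid \O_X x) (pregerm_map (rq_repr g)).

Lemma stalk_map_pi (g : pregerm \O_Y (f x)) :
  stalk_map (@rq_pi (stalk_setoid \O_Y (f x)) g) =
  @rq_pi (stalk_setoid \O_X x) (pregerm_map g).
Proof.
apply/rq_piP; have /= := @rq_repr_pi (stalk_setoid \O_Y (f x)) g.
set g' := rq_repr _; move: g' => g' [W [k [l [Wx e]]]].
have k' : preim f W `<=`
  preim f (pg_open g') by move=> y /k.
have l' : preim f W `<=`
  preim f (pg_open g) by move=> y /l.
exists (preim f W), k', l'; split=> //=.
by rewrite -!(rsm_nat _) e.
Qed.

End StalkMap.

Definition locally_ringed (X : ringed_space) : Prop :=
  forall x : X, local_ring (stalk \O_X x).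

Definition is_local_mor (X Y : ringed_space) (f : rs_mor X Y) : Prop :=
  forall x : X, local_hom (@stalk_map X Y f x).

Section Localization.
Variables (A : comPzRingType) (p : set A) (pP : prime_ideal p).

Record fraction := Fraction {
  numer : A;
  denom : A;
  denomP : ~ p denom
}.

Lemma prime1 : ~ p 1. Proof. by case: pP. Qed.

Lemma primeM (a b : A) : ~ p a -> ~ p b -> ~ p (a * b).
Proof. by case: pP => _ _ pM pa pb /pM []. Qed.

Definition fraction_eq (x y : fraction) : Prop :=
  exists2 u, ~ p u & u * (numer x * denom y) = u * (numer y * denom x).

Lemma fraction_eq1 (x y : fraction) :
  numer x * denom y = numer y * denom x -> fraction_eq x y.
Proof. by move=> e; exists 1; [exact: prime1 | rewrite e]. Qed.

Definition localization_setoid : setoid_ring.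
Proof.
refine (@SetoidRing fraction fraction_eq
  (@Fraction 0 1 prime1) (@Fraction 1 1 prime1)
  (fun x => @Fraction (- numer x) (denom x) (@denomP x))
  (fun x y => @Fraction (numer x * denom y + numer y * denom x)
    (denom x * denom y) (primeM (@denomP x) (@denomP y)))
  (fun x y => @Fraction (numer x * numer y)
    (denom x * denom y) (primeM (@denomP x) (@denomP y)))
  _ _ _ _ _ _ _ _ _ _ _ _ _ _).
- by move=> x; exact: fraction_eq1.
- by move=> x y [u pu e]; exists u.
- move=> [a b pb] [c d pd] [e f pf] [u pu /= h] [v pv /= k].
  exists (u * v * d); first by do 2?apply: primeM.
  rewrite /=.
  transitivity (v * f * (u * (a * d))); first by ring.
  rewrite h; transitivity (u * b * (v * (c * f))); first by ring.
  by rewrite k; ring.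
- move=> [a b pb] [c d pd] [u pu /= h]; exists u => //=.
  transitivity (- (u * (a * d))); first by ring.
  by rewrite h; ring.
- move=> [a b pb] [a' b' pb'] [c d pd] [c' d' pd'] [u pu /= h] [v pv /= k].
  exists (u * v); first exact: primeM.
  rewrite /=; transitivity (v * d * d' * (u * (a * b')) +
    u * b * b' * (v * (c * d'))); first by ring.
  by rewrite h k; ring.
- move=> [a b pb] [a' b' pb'] [c d pd] [c' d' pd'] [u pu /= h] [v pv /= k].
  exists (u * v); first exact: primeM.
  rewrite /=; transitivity ((u * (a * b')) * (v * (c * d'))); first by ring.
  by rewrite h k; ring.
- by move=> *; apply: fraction_eq1 => /=; ring.
- by move=> *; apply: fraction_eq1 => /=; ring.
- by move=> *; apply: fraction_eq1 => /=; ring.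
- by move=> *; apply: fraction_eq1 => /=; ring.
- by move=> *; apply: fraction_eq1 => /=; ring.
- by move=> *; apply: fraction_eq1 => /=; ring.
- by move=> *; apply: fraction_eq1 => /=; ring.
- by move=> *; apply: fraction_eq1 => /=; ring.
Defined.

Definition localization : comPzRingType := ring_quot localization_setoid.

Definition frac (a b : A) (pb : ~ p b) : localization :=
  @rq_pi localization_setoid (@Fraction a b pb).

Lemma fracD a b c d (pb : ~ p b) (pd : ~ p d) :
  frac a pb + frac c pd = frac (a * d + c * b) (primeM pb pd).
Proof. exact: (@rq_addE localization_setoid). Qed.

Lemma fracM a b c d (pb : ~ p b) (pd : ~ p d) :
  frac a pb * frac c pd = frac (a * c) (primeM pb pd).
Proof. exact: (@rq_mulE localization_setoid). Qed.

Lemma fracN a b (pb : ~ p b) : - frac a pb = frac (- a) pb.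
Proof. exact: (@rq_oppE localization_setoid). Qed.

Lemma frac0 : 0 = frac 0 prime1. Proof. by []. Qed.
Lemma frac1 : 1 = frac 1 prime1. Proof. by []. Qed.

End Localization.

Section Spectrum.
Variable A : comPzRingType.

Record spectrum := Spectrum {
  spec_ideal :> set A;
  spec_prime : prime_ideal spec_ideal
}.

HB.instance Definition _ := gen_eqMixin spectrum.
HB.instance Definition _ := gen_choiceMixin spectrum.

Definition zariski_closed (E : set A) : set spectrum :=
  [set p : spectrum | E `<=` p].

Definition zariski_open : set_system spectrum :=
  [set U | exists E, U = ~` zariski_closed E].

Lemma zariski_openT : zariski_open setT.
Proof.
exists setT; apply/seteqP; split=> // p _ /(_ 1 I).
by case: (spec_prime p).
Qed.

Lemma zariski_openI : setI_closed zariski_open.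
Proof.
move=> _ _ [E ->] [E' ->].
exists [set c | exists a b, [/\ E a, E' b & c = a * b]].
rewrite -setCU; congr (~` _); apply/seteqP; split=> p /=.
  have [[_ _ pM] _ _] := spec_prime p.
  by move=> [Ep|Ep] _ [a [b [Ea Eb ->]]]; [rewrite mulrC|]; apply: pM;
    exact: Ep.
move=> h; have [_ _ pP] := spec_prime p.
have [Ep|/existsNP[a /not_implyP[Ea pa]]] := pselect (E `<=` p); first by left.
right=> b Eb; have : spec_ideal p (a * b) by apply: h; exists a, b.
by move/pP => [].
Qed.

Lemma zariski_open_bigU (I : Type) (f : I -> set spectrum) :
  (forall i, zariski_open (f i)) -> zariski_open (\bigcup_i f i).
Proof.
move=> fo.
exists [set a | exists i E, f i = ~` zariski_closed E /\ E a].
apply/seteqP; split=> p /=.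
  move=> [i _ fip] h; have [E fiE] := fo i; move: fip; rewrite fiE; apply.
  by move=> a Ea; apply: h; exists i, E.
move=> /existsNP[a /not_implyP[[i [E [fiE Ea]]] pa]].
by exists i => //; rewrite fiE => /(_ a Ea).
Qed.

HB.instance Definition _ := isOpenTopological.Build spectrum
  zariski_openT zariski_openI zariski_open_bigU.

Definition spec_loc (p : spectrum) : comPzRingType :=
  localization (spec_prime p).

(* Sections over [U] are families of elements of the localizations at the primes
   in [U] that are locally given by a single fraction. *)
Section SpecSections.
Variable U : opens spectrum.

Definition locally_fraction
    (s : forall p : spectrum, opens_set U p -> spec_loc p) : Prop :=
  forall p : spectrum, opens_set U p ->
  exists (V : opens spectrum) (VU : V `<=` U) (a b : A),
    opens_set V p /\
    forall (q : spectrum) (Vq : opens_set V q),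
      exists qb : ~ spec_ideal q b, s q (VU q Vq) = frac (spec_prime q) a qb.

Record spec_section := SpecSection {
  spec_fun :> forall p : spectrum, opens_set U p -> spec_loc p;
  spec_funP : locally_fraction spec_fun
}.

Lemma spec_fun_irr (s : spec_section) p (u v : opens_set U p) :
  s p u = s p v.
Proof. by rewrite (Prop_irrelevance u v). Qed.

Lemma spec_section_eq (s t : spec_section) :
  (forall p Up, s p Up = t p Up) -> s = t.
Proof.
case: s t => [s sP] [t tP] /= st.
have e : s = t.
  by do 2!(apply: functional_extensionality_dep => ?); exact: st.
by subst t; rewrite (Prop_irrelevance sP tP).
Qed.

HB.instance Definition _ := gen_eqMixin spec_section.
HB.instance Definition _ := gen_choiceMixin spec_section.

Lemma locally_fraction_const (a : A) :
  locally_fraction (fun p _ => frac (spec_prime p) a (prime1 (spec_prime p))).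
Proof.
move=> p Up; have UU : U `<=` U by [].
by exists U, UU, a, 1; split=> // q Uq; exists (prime1 (spec_prime q)).
Qed.

Lemma locally_fractionN (s : spec_section) :
  locally_fraction (fun p Up => - s p Up).
Proof.
move=> p /(spec_funP s)[V [VU [a [b [Vp sab]]]]].
exists V, VU, (- a), b; split=> // q Vq; have [qb ->] := sab q Vq.
by exists qb; rewrite fracN.
Qed.

Lemma locally_fractionD (s t : spec_section) :
  locally_fraction (fun p Up => s p Up + t p Up).
Proof.
move=> p Up; have [V [VU [a [b [Vp sab]]]]] := spec_funP s Up.
have [W [WU [c [d [Wp tcd]]]]] := spec_funP t Up.
have NU : opens_cap V W `<=` U by move=> q [/VU].
exists (opens_cap V W), NU, (a * d + c * b), (b * d); split=> // q Nq.
have [Vq Wq] := Nq.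
have [[qb sq] [qd tq]] := (sab q Vq, tcd q Wq).
exists (primeM (spec_prime q) qb qd).
by rewrite -fracD -sq -tq; congr (_ + _); exact: spec_fun_irr.
Qed.

Lemma locally_fractionM (s t : spec_section) :
  locally_fraction (fun p Up => s p Up * t p Up).
Proof.
move=> p Up; have [V [VU [a [b [Vp sab]]]]] := spec_funP s Up.
have [W [WU [c [d [Wp tcd]]]]] := spec_funP t Up.
have NU : opens_cap V W `<=` U by move=> q [/VU].
exists (opens_cap V W), NU, (a * c), (b * d); split=> // q Nq.
have [Vq Wq] := Nq.
have [[qb sq] [qd tq]] := (sab q Vq, tcd q Wq).
exists (primeM (spec_prime q) qb qd).
by rewrite -fracM -sq -tq; congr (_ * _); exact: spec_fun_irr.
Qed.

Definition spec_zero : spec_section := SpecSection (locally_fraction_const 0).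
Definition spec_one : spec_section := SpecSection (locally_fraction_const 1).
Definition spec_opp s : spec_section := SpecSection (locally_fractionN s).
Definition spec_add s t : spec_section := SpecSection (locally_fractionD s t).
Definition spec_mul s t : spec_section := SpecSection (locally_fractionM s t).

Lemma spec_addA : associative spec_add.
Proof. by move=> s t u; apply: spec_section_eq => p Up; exact: addrA. Qed.
Lemma spec_addC : commutative spec_add.
Proof. by move=> s t; apply: spec_section_eq => p Up; exact: addrC. Qed.
Lemma spec_add0 : left_id spec_zero spec_add.
Proof. by move=> s; apply: spec_section_eq => p Up; exact: add0r. Qed.
Lemma spec_addN : left_inverse spec_zero spec_opp spec_add.
Proof. by move=> s; apply: spec_section_eq => p Up; exact: addNr. Qed.
Lemma spec_mulA : associative spec_mul.
Proof. by move=> s t u; apply: spec_section_eq => p Up; exact: mulrA. Qed.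
Lemma spec_mulC : commutative spec_mul.
Proof. by move=> s t; apply: spec_section_eq => p Up; exact: mulrC. Qed.
Lemma spec_mul1 : left_id spec_one spec_mul.
Proof. by move=> s; apply: spec_section_eq => p Up; exact: mul1r. Qed.
Lemma spec_mulD : left_distributive spec_mul spec_add.
Proof. by move=> s t u; apply: spec_section_eq => p Up; exact: mulrDl. Qed.

HB.instance Definition _ := GRing.isZmodule.Build spec_section
  spec_addA spec_addC spec_add0 spec_addN.
HB.instance Definition _ := GRing.Zmodule_isComPzRing.Build spec_section
  spec_mulA spec_mulC spec_mul1 spec_mulD.

End SpecSections.

Section SpecRestriction.
Variables (U V : opens spectrum) (h : V `<=` U).

Lemma locally_fraction_res (s : spec_section U) :
  locally_fraction (fun p Vp => s p (h Vp) : spec_loc p).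
Proof.
move=> p Vp; have [W [WU [a [b [Wp sab]]]]] := spec_funP s (h Vp).
have NV : opens_cap W V `<=` V by move=> q [].
exists (opens_cap W V), NV, a, b; split=> // q Nq.
have [Wq _] := Nq; have [qb sq] := sab q Wq.
by exists qb; rewrite -sq; exact: spec_fun_irr.
Qed.

Definition spec_res (s : spec_section U) : spec_section V :=
  SpecSection (locally_fraction_res s).

Lemma spec_res_zmod : zmod_morphism spec_res.
Proof. by move=> s t; exact: spec_section_eq. Qed.

Lemma spec_res_monoid : monoid_morphism spec_res.
Proof. by split=> [|s t]; exact: spec_section_eq. Qed.

HB.instance Definition _ := GRing.isZmodMorphism.Build
  (spec_section U) (spec_section V) spec_res spec_res_zmod.
HB.instance Definition _ := GRing.isMonoidMorphism.Build
  (spec_section U) (spec_section V) spec_res spec_res_monoid.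

End SpecRestriction.

Definition spec_presheaf : presheaf spectrum.
Proof.
refine (@Presheaf spectrum (fun U => spec_section U : comPzRingType)
  (fun U V h => @spec_res U V h : {rmorphism spec_section U -> spec_section V})
  _ _).
- by move=> U h s; apply: spec_section_eq => p Up; exact: (spec_fun_irr s).
- by move=> U V W h k l s; apply: spec_section_eq => p Wp; exact: (spec_fun_irr s).
Defined.

Lemma spec_sheaf : is_sheaf spec_presheaf.
Proof.
move=> U I V h cover s compat.
have sE i j p (ip : opens_set (V i) p) (jp : opens_set (V j) p) :
    s i p ip = s j p jp.
  have ijp : opens_set (opens_cap (V i) (V j)) p by [].
  have /= e := congr1 (fun t : spec_section (opens_cap (V i) (V j)) =>
    t p ijp) (compat i j).
  rewrite (spec_fun_irr (s i) ip (opens_capl ijp)) e.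
  exact: (spec_fun_irr (s j)).
have ex p (Up : opens_set U p) : exists i, opens_set (V i) p.
  by have [i _ Vp] := cover p Up; exists i.
pose t p Up : spec_loc p := s (projT1 (cid (ex p Up))) p (projT2 (cid (ex p Up))).
have tE i p Up (ip : opens_set (V i) p) : t p Up = s i p ip by exact: sE.
have tP : locally_fraction t.
  move=> p Up; have [i ip] := ex p Up.
  have [W [WV [a [b [Wp sab]]]]] := spec_funP (s i) ip.
  exists W, (subset_trans WV (h i)), a, b; split=> // q Wq.
  have [qb sq] := sab q Wq; exists qb.
  by rewrite (tE i q _ (WV q Wq)).
exists (SpecSection tP); split=> [i|t' t'E].
  by apply: spec_section_eq => p ip; exact: tE.
apply: spec_section_eq => p Up; have [i ip] := ex p Up.
rewrite /= (tE i p Up ip) -(t'E i) /=; exact: spec_fun_irr.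
Qed.

Definition Spec : ringed_space := RingedSpace spec_sheaf.

End Spectrum.

(* An isomorphism of ringed spaces between locally ringed spaces is automatically
   an isomorphism of locally ringed spaces, hence [rs_iso]. *)
Record scheme := Scheme {
  scheme_space :> ringed_space;
  scheme_local : locally_ringed scheme_space;
  scheme_affine : forall x : scheme_space,
    exists U : opens scheme_space, opens_set U x /\
    exists A : comPzRingType, rs_iso (restriction U) (Spec A)
}.

Record scheme_mor (X Y : scheme) := SchemeMor {
  scheme_mor_rs :> rs_mor X Y;
  scheme_mor_local : is_local_mor scheme_mor_rs
}.

Lemma scheme_mor_eq (X Y : scheme) (f g : scheme_mor X Y) :
  scheme_mor_rs f = scheme_mor_rs g -> f = g.
Proof.
case: f g => [f fl] [g gl] /= fg; subst g.
by rewrite (Prop_irrelevance fl gl).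
Qed.

Lemma scheme_id_local (X : scheme) : is_local_mor (rs_id X).
Proof.
move=> x m n mM nM.
have [k [_ kU]] := scheme_local x.
have <- : m = n by rewrite -(kU m mM) -(kU n nM).
suff e (g : stalk \O_X x) : @stalk_map X X (rs_id X) x g = g.
  by move=> _ [g mg <-]; rewrite [X in m X]e.
rewrite -[X in stalk_map X](rq_reprK g) -[RHS](rq_reprK g).
rewrite (@stalk_map_pi X X (rs_id X) x); apply/rq_piP.
set h := rq_repr g; pose U := pg_open h.
have k1 : U `<=` opens_preimage (rs_id_cont (X := X)) U by [].
have k2 : U `<=` U by [].
exists U, k1, k2; split; first exact: pg_mem.
by rewrite /= resT; exact: res_irr.
Qed.

Lemma scheme_comp_local (X Y Z : scheme) (g : scheme_mor Y Z)
  (f : scheme_mor X Y) : is_local_mor (rs_comp g f).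
Proof.
move=> x m n mM nM.
have [k [kM _]] := scheme_local (f x).
suff e (a : stalk \O_Z (g (f x))) : @stalk_map X Z (rs_comp g f) x a =
    @stalk_map X Y f x (@stalk_map Y Z g (f x) a).
  move=> _ [a ma <-]; rewrite [X in n X]e.
  apply: (@scheme_mor_local _ _ f x _ _ kM nM); exists (@stalk_map Y Z g (f x) a) => //.
  by apply: (@scheme_mor_local _ _ g (f x) _ _ mM kM); exists a.
rewrite -[a]rq_reprK (@stalk_map_pi X Z) (@stalk_map_pi Y Z) (@stalk_map_pi X Y).
apply/rq_piP; set h := rq_repr a.
pose U := opens_preimage (@rs_comp_cont _ _ _ g f) (pg_open h).
have k1 : U `<=` U by [].
have k2 : U `<=` opens_preimage (@rsm_cont _ _ f)
  (opens_preimage (@rsm_cont _ _ g) (pg_open h)) by [].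
exists U, k1, k2; split; first exact: (pg_mem h).
by rewrite /= resT; exact: res_irr.
Qed.

Definition scheme_id (X : scheme) : scheme_mor X X :=
  SchemeMor (@scheme_id_local X).

Definition scheme_comp (X Y Z : scheme) (g : scheme_mor Y Z)
    (f : scheme_mor X Y) : scheme_mor X Z :=
  SchemeMor (@scheme_comp_local _ _ _ g f).

Definition Sch : category.
Proof.
refine (@Category scheme scheme_mor scheme_id scheme_comp _ _ _) => *;
  apply: scheme_mor_eq.
- exact: rs_comp_idl.
- exact: rs_comp_idr.
- exact: rs_comp_assoc.
Defined.

Definition specializes (E : topologicalType) (x y : E) : Prop :=
  closure [set x] y.

Definition specialization_graph (E : topologicalType) : Grph :=
  @Graph E [set e | specializes e.1 e.2].

(* Main.v *)
Require Import Defs.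
From mathcomp Require Import all_boot all_algebra all_classical topology.

(** Only continuity matters: a continuous [f] maps the closure of [[set x]] into the closure of
    [[set f x]] ([specializes_continuous]), so the point map of a morphism of schemes is a graph
    homomorphism. *)

Lemma specializes_continuous (E F : topologicalType) (f : E -> F) (x y : E) :
  continuous f -> specializes x y -> specializes (f x) (f y).
Proof.
(* [B] is a neighbourhood of [f y]; its preimage is one of [y], hence contains [x]. *)
move=> cf xy B /cf /xy[_ [-> Bfx]].
by exists (f x).
Qed.

Definition specialization_map (X Y : scheme) (f : scheme_mor X Y) :
    graph_hom (specialization_graph X) (specialization_graph Y) :=
  @GraphHom (specialization_graph X) (specialization_graph Y) f
    (fun x y => @specializes_continuous X Y f x y (rsm_cont (r:=f))).

Theorem theorem1p6 :
  let Gamma0 (X : Sch) : Grph := specialization_graph (X : scheme) in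
  exists Gamma1 : forall X Y : Sch, mor X Y -> mor (Gamma0 X) (Gamma0 Y),
    is_functor Gamma1 /\
    forall (X Y : scheme) (f : scheme_mor X Y) (x y : X),
      specializes x y ->
      (vmap (Gamma1 X Y f) x, vmap (Gamma1 X Y f) y) = (f x, f y) /\
      specializes (f x) (f y).
Proof.
exists specialization_map; split.
  (* A graph homomorphism is determined by its vertex map, and on points identities and composites
     of schemes are those of functions by definition. *)
  by split=> *; exact: graph_hom_eq.
move=> X Y f x y xy; split=> //.
exact: specializes_continuous (@rsm_cont _ _ f) xy.
Qed.
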